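(* Let $K\in\mathcal{T}_h$ be an element of a uniform rectangular mesh in $\mathbb{R}^2$ with meshsize $h$. For any $u\in P_4(K)$ and $v\in P_T(K)=P_2(K)+\mathrm{span}\{x_1^3,x_2^3\}$, there holds that $$(\nabla^2(u-\Pi_Ku),\nabla^2v)_{L^2(K)}=\frac{h^2}{3}\int_K\frac{\partial^3u}{\partial x_1\partial x_2^2}\frac{\partial^3v}{\partial x_1^3}\,dx_1dx_2+\frac{h^2}{3}\int_K\frac{\partial^3u}{\partial x_1^2\partial x_2}\frac{\partial^3v}{\partial x_2^3}\,dx_1dx_2.$$
   Context: $P_l(K)$ denotes the polynomials of degree $\le l$ on $K$; $\nabla^2w$ is the Hessian matrix of $w$, and $(\nabla^2 w,\nabla^2 v)_{L^2(K)}=\int_K\sum_{i,j=1}^2\partial_{ij}w\,\partial_{ij}v$. With $(x_{1,c},x_{2,c})$ the center of $K$, the map $\xi_i=(x_i-x_{i,c})/h$, $i=1,2$, sends $K$ onto $[-1,1]^2$ (so $K$ is an axis-parallel square of side $2h$). The canonical interpolation operator $\Pi_K:H^3(K)\to P_T(K)$ of the rectangular Morley element is defined by $(\Pi_Kv)(P)=v(P)$ for each of the 4 vertices $P$ of $K$ and $\int_F\frac{\partial\Pi_Kv}{\partial\nu_F}\,ds=\int_F\frac{\partial v}{\partial\nu_F}\,ds$ for each of the 4 edges $F$ of $K$ ($\nu_F$ a unit normal to $F$); these 8 conditions are unisolvent on $P_T(K)$. *)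

(* Defs.v *)
From HB Require Import structures.
From mathcomp Require Import all_boot all_order all_algebra.
From mathcomp Require Import all_classical all_reals all_analysis.

Set Implicit Arguments.
Unset Strict Implicit.
Unset Printing Implicit Defensive.

Import Order.TTheory GRing.Theory Num.Theory.
Import numFieldNormedType.Exports.

Local Open Scope classical_set_scope.
Local Open Scope ring_scope.

(* Points of the plane are pairs; the coordinate directions x_1, x_2 are
   indexed by 'I_2, with 0 for x_1 and 1 for x_2. *)

Definition x1dir : 'I_2 := ord0.
Definition x2dir : 'I_2 := ord_max.

Definition unit_vec (R : realType) (i : 'I_2) : R * R :=
  if i == x1dir then (1, 0) else (0, 1).

Definition pderiv (R : realType) (i : 'I_2) (f : R * R -> R) : R * R -> R :=
  fun x => 'D_(unit_vec R i) f x.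

Definition hessian (R : realType) (f : R * R -> R) (x : R * R) : 'M[R]_2 :=
  \matrix_(i < 2, j < 2) pderiv i (pderiv j f) x.

Definition area (R : realType) : set (R * R) -> \bar R :=
  ((@lebesgue_measure R) \x (@lebesgue_measure R))%E.

Definition hess_inner (R : realType) (K : set (R * R)) (w v : R * R -> R) : R :=
  \int[@area R]_(x in K)
    \sum_(i < 2) \sum_(j < 2) hessian w x i j * hessian v x i j.

(* The square that x |-> (x - c) / h maps onto [-1, 1]^2; its side is 2h. *)
Definition square (R : realType) (c : R * R) (h : R) : set (R * R) :=
  `[c.1 - h, c.1 + h] `*` `[c.2 - h, c.2 + h].

(* A polynomial on a nondegenerate square is identified with the polynomial
   function on the whole plane that extends it. *)
Definition poly_space (R : realType) (l : nat) : set (R * R -> R) :=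
  [set f | exists a : nat -> nat -> R, forall x : R * R,
    f x = \sum_(i < l.+1) \sum_(j < l.+1 | (i + j <= l)%N)
            a i j * x.1 ^+ i * x.2 ^+ j].

Definition morley_space (R : realType) : set (R * R -> R) :=
  [set f | exists2 p, poly_space 2 p & exists a b : R, forall x : R * R,
    f x = p x + a * x.1 ^+ 3 + b * x.2 ^+ 3].

(* Below, a boolean s stands for the sign (-1) ^+ s. *)

Definition vertex (R : realType) (c : R * R) (h : R) (s t : bool) : R * R :=
  (c.1 + (-1) ^+ s * h, c.2 + (-1) ^+ t * h).

(* The edge with outward unit normal (-1)^s e_i, parametrized by arc length
   through r in [-h, h]. *)
Definition edge_point (R : realType) (c : R * R) (h : R)
    (i : 'I_2) (s : bool) (r : R) : R * R :=
  if i == x1dir then (c.1 + (-1) ^+ s * h, c.2 + r)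
  else (c.1 + r, c.2 + (-1) ^+ s * h).

Definition edge_normal (R : realType) (i : 'I_2) (s : bool) : R * R :=
  (-1) ^+ s *: unit_vec R i.

Definition edge_flux (R : realType) (c : R * R) (h : R)
    (i : 'I_2) (s : bool) (f : R * R -> R) : R :=
  \int[@lebesgue_measure R]_(r in `[- h, h])
    'D_(edge_normal R i s) f (edge_point c h i s r).

Definition morley_interpolates (R : realType) (c : R * R) (h : R)
    (f w : R * R -> R) : Prop :=
  [/\ morley_space w,
      forall s t : bool, w (vertex c h s t) = f (vertex c h s t)
    & forall (i : 'I_2) (s : bool), edge_flux c h i s w = edge_flux c h i s f].

(* The zero default is only relevant when no interpolant exists. *)
Definition morley_interp (R : realType) (c : R * R) (h : R)
    (f : R * R -> R) : R * R -> R :=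
  xget (fun=> 0) [set w | morley_interpolates c h f w].

(* Main.v *)
Require Import Defs.
From mathcomp Require Import all_boot all_order all_algebra.
From mathcomp Require Import polyXY ring measurable_realfun.
From mathcomp Require Import all_classical all_reals all_analysis.

(** Let w = u - Pi u, so that w vanishes at the four vertices and its normal
    derivative has mean zero on each edge.  Nothing else about the interpolant
    matters, apart from the fact that its third derivatives d_122 and d_112
    vanish.  The three kinds of terms of (Hess w, Hess v) behave as follows.

    - d_12 v is constant and the integral of d_12 w over K is the alternating
      sum of the vertex values of w, so the mixed terms vanish
      ([integral_mixed_derivative]).

    - d_11 v is an affine function g of x_1 alone, of slope d_111 v.
      Integrating d_11 w * g by parts in x_1, the boundary terms are edge means
      of d_1 w times constants, hence vanish, and - d_111 v times the integral
      of d_1 w is left.  That integral is the integral over x_2 of the jump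
      q(x_2) = w(c_1 + h, x_2) - w(c_1 - h, x_2).  The monomial x_2^4 has a
      constant coefficient in w, so q is a cubic, and it vanishes at both ends
      of its interval.  The trapezoidal rule with its first correction,

        int q = h (q(c_2 + h) + q(c_2 - h)) - (h^2 / 3) int q'',

      is exact on cubics ([corrected_trapezoid]), so the integral of d_1 w is
      - h^2 / 3 times the integral of d_122 w = d_122 u
      ([integral_dx_vanishing]).  This is where the factor h^2 / 3 comes from.

    - The terms d_22 w * d_22 v follow by exchanging the coordinates.

    To make differentiation and exchange of coordinates algebraic, all functions
    are represented by bivariate polynomials, i.e. elements of {poly {poly R}}
    with the outer variable 'X standing for x_1 and the inner variable 'Y for
    x_2; the only analytic inputs are the fundamental theorem of calculus for
    polynomials and Fubini's theorem on the square.

    The interpolation operator is defined by choice among the interpolants, so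
    an interpolant has to be exhibited ([morley_interpolates_exist]).  Written in
    coordinates centred at c, the element p(x_1) + q(x_2) + a x_1 x_2 decouples
    the conditions: its flux through an edge normal to x_1 only involves p', and
    the linear system can be solved by hand. *)

Set Implicit Arguments.
Unset Strict Implicit.
Unset Printing Implicit Defensive.

Import Order.TTheory GRing.Theory Num.Theory.
Import numFieldNormedType.Exports.

Local Open Scope classical_set_scope.
Local Open Scope ring_scope.

(** * Integrals of univariate polynomials *)

Section OneVariable.
Variable R : realType.
Implicit Types (p q : {poly R}) (a b c h : R).

Lemma centered_lt c h : 0 < h -> c - h < c + h.
Proof. by move=> h0; rewrite ltrBlDr -addrA ltrDl addr_gt0. Qed.

Lemma integrable_horner p a b :
  (@lebesgue_measure R).-integrable `[a, b] (EFin \o horner p).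
Proof.
apply: continuous_compact_integrable; first exact: segment_compact.
exact/continuous_subspaceT/continuous_horner.
Qed.

Lemma integral_deriv p a b : a < b ->
  \int[@lebesgue_measure R]_(x in `[a, b]) p^`().[x] = p.[b] - p.[a].
Proof.
move=> ab; rewrite /Rintegral (@continuous_FTC2 _ _ (horner p)) //.
- exact/continuous_subspaceT/continuous_horner.
- split=> [x _||]; first exact: derivable_horner.
  + by apply: cvg_at_right_filter; exact: continuous_horner.
  + by apply: cvg_at_left_filter; exact: continuous_horner.
- by move=> x _; rewrite derivE.
Qed.

Lemma poly_primitive p : exists q, q^`() = p.
Proof.
exists (\poly_(i < (size p).+1) (p`_i.-1 / i%:R)).
apply/polyP => i; rewrite coef_deriv coef_poly ltnS /=.
case: ltnP => [_|sp]; last by rewrite mul0rn nth_default.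
by rewrite -[LHS]mulr_natr divfK // pnatr_eq0.
Qed.

Definition segment_integral a h p : R :=
  \int[@lebesgue_measure R]_(x in `[a - h, a + h]) p.[x].

Lemma segment_integralB a h p q :
  segment_integral a h (p - q) = segment_integral a h p - segment_integral a h q.
Proof.
rewrite /segment_integral -RintegralB //; try exact: integrable_horner.
by apply: eq_Rintegral => x _; rewrite !hornerE.
Qed.

Lemma segment_integralZ a h b p :
  segment_integral a h (b *: p) = b * segment_integral a h p.
Proof.
rewrite /segment_integral -RintegralZl //; last exact: integrable_horner.
by apply: eq_Rintegral => x _; rewrite !hornerE.
Qed.

Lemma segment_integral_deriv a h p : 0 < h ->
  segment_integral a h p^`() = p.[a + h] - p.[a - h].
Proof. by move=> h0; rewrite /segment_integral integral_deriv // centered_lt. Qed.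

(** Fluxes are integrals over the arc length parameter in [-h, h], whereas
    integration over the square produces integrals over [c - h, c + h]. *)
Lemma integral_shift p c h : 0 < h ->
  \int[@lebesgue_measure R]_(r in `[- h, h]) p.[c + r] = segment_integral c h p.
Proof.
move=> h0; have [q <-] := poly_primitive p.
have -> : (fun r => q^`().[c + r]) = horner (q \Po ('X + c%:P))^`().
  by apply/funext => r; rewrite deriv_comp !hornerE horner_comp !hornerE
    derivD derivX derivC !hornerE addrC.
rewrite segment_integral_deriv // integral_deriv; last first.
  by rewrite -subr_gt0 opprK addr_gt0.
by rewrite !horner_comp !hornerE [h + c]addrC [- h + c]addrC.
Qed.

(** The Peano kernel of the rule is k = (t^2 - h^2)^2 / 24, where t = x - c: it
    vanishes to second order at both ends, and k'' = (t^2 - h^2 / 3) / 2 takes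
    the value h^2 / 3 there.  Hence p t - p' k'' + p'' k' - p''' k has derivative
    p - p'''' k and end values p t - (h^2 / 3) p'. *)
Lemma corrected_trapezoid p c h : 0 < h -> p^`()^`()^`()^`() = 0 ->
  segment_integral c h p =
  h * (p.[c + h] + p.[c - h]) - h ^+ 2 / 3 * segment_integral c h p^`()^`().
Proof.
move=> h0 p40.
pose t : {poly R} := 'X - c%:P.
pose H : {poly R} := (h ^+ 2)%:P.
pose e : {poly R} := (24^-1)%:P.
have t' : t^`() = 1 by rewrite /t derivB derivX derivC subr0.
have e24 : e *+ 24 = 1.
  by rewrite /e -polyCMn -[24^-1 *+ 24]mulr_natr mulVf ?pnatr_eq0.
pose P := p * t - p^`() * (e * (t ^+ 2 *+ 12 - H *+ 4)) +
  p^`()^`() * (e * (t * (t ^+ 2 - H) *+ 4)) -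
  p^`()^`()^`() * (e * (t ^+ 2 - H) ^+ 2).
have P' : P^`() = p.
  rewrite /P !(derivD, derivM, derivMn, derivC, t', derivX, derivN, expr2) p40.
  (* The terms in which 24 e has to be replaced by 1 are collected here. *)
  transitivity (p + (- p^`() * t) * (e *+ 24 - 1)); last first.
    by rewrite e24 subrr mulr0 addr0.
  ring.
have PE x : (x - c) ^+ 2 = h ^+ 2 ->
    P.[x] = p.[x] * (x - c) - p^`().[x] * (h ^+ 2 / 3).
  by move=> xc; rewrite /P !(hornerE, hornerMn) /= xc; field.
by rewrite -{1}P' !segment_integral_deriv// !PE; [field | ring | ring].
Qed.

Lemma segment_integral_affine a h A B : 0 < h ->
  segment_integral a h (A%:P + B *: ('X - a%:P)) = 2 * h * A.
Proof.
move=> h0; set p := _ + _.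
have p' : p^`() = B%:P.
  by rewrite /p derivD derivZ derivB derivX !derivC subr0 add0r alg_polyC.
rewrite corrected_trapezoid //; last by rewrite p' !derivC.
rewrite segment_integral_deriv // p' /p.
rewrite !(hornerD, hornerC, hornerN, hornerZ, hornerX).
ring.
Qed.

End OneVariable.

(** * Bivariate polynomials as functions on the plane *)

Section TwoVariables.
Variable R : realType.
Implicit Types (q : {poly R}) (P Q : {poly {poly R}}) (z v : R * R).

Definition eval2 P z : R := P.[z.1, z.2].

Lemma eval2D P Q z : eval2 (P + Q) z = eval2 P z + eval2 Q z.
Proof. by rewrite /eval2 !hornerE. Qed.

Lemma eval2B P Q z : eval2 (P - Q) z = eval2 P z - eval2 Q z.
Proof. by rewrite /eval2 !hornerE. Qed.

Lemma eval2M P Q z : eval2 (P * Q) z = eval2 P z * eval2 Q z.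
Proof. by rewrite /eval2 !hornerE. Qed.

Lemma eval2C (a : R) z : eval2 a%:P%:P z = a.
Proof. by rewrite /eval2 !hornerE. Qed.

Lemma eval2_swap P z : eval2 (swapXY P) z = eval2 P (z.2, z.1).
Proof. exact: horner2_swapXY. Qed.

(** The decomposition along which continuity, measurability and
    differentiability are all proved by induction on the outer degree. *)
Lemma eval2_MXaddC P q :
  eval2 (P * 'X + q%:P) = eval2 P * fst + (fun z => q.[z.2]).
Proof. by apply/funext => w; rewrite /eval2 !hornerE. Qed.

Lemma eval2_0 : eval2 0 = cst 0.
Proof. by apply/funext => ?; rewrite /eval2 !horner0. Qed.

Definition derivY P : {poly {poly R}} := map_poly deriv P.

Lemma derivY_coef P i : (derivY P)`_i = (P`_i)^`().
Proof. by rewrite coef_map_id0 ?deriv0. Qed.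

Lemma derivYE P : derivY P = swapXY (swapXY P)^`().
Proof.
apply/polyP => i; apply/polyP => j.
by rewrite derivY_coef coef_swapXY !coef_deriv coefMn coef_swapXY.
Qed.

Lemma swapXY_deriv P : swapXY P^`() = derivY (swapXY P).
Proof. by rewrite derivYE swapXYK. Qed.

Lemma swapXY_derivY P : swapXY (derivY P) = (swapXY P)^`().
Proof. by rewrite derivYE swapXYK. Qed.

Lemma derivYB P Q : derivY (P - Q) = derivY P - derivY Q.
Proof. by rewrite /derivY raddfB. Qed.

Lemma derivYC q : derivY q%:P = q^`()%:P.
Proof. by rewrite /derivY map_polyC. Qed.

Lemma derivY_deriv P : derivY P^`() = (derivY P)^`().
Proof.
by apply/polyP => i; rewrite derivY_coef !coef_deriv derivY_coef derivMn.
Qed.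

Lemma horner_derivY P (x : R) : (derivY P).[x%:P] = (P.[x%:P])^`().
Proof. by rewrite derivYE horner_swapXY -deriv_map -horner_swapXY swapXYK. Qed.

Lemma deriv_eq0_polyC P : P^`() = 0 -> P = (P`_0)%:P.
Proof.
move=> P'0; apply/polyP => -[|i]; rewrite coefC //=.
apply/polyP => j; have := congr1 (fun Q => Q`_i`_j) P'0.
by rewrite /= coef_deriv coefMn !coef0 => /eqP; rewrite mulrn_eq0 => /eqP.
Qed.

Lemma is_derive_linear (f : {linear (R * R)%type -> R^o}) z v :
  continuous f -> is_derive z v f (f v).
Proof.
move=> fcont; apply: DeriveDef.
  exact/diff_derivable/linear_differentiable.
by rewrite deriveE ?diff_lin //; exact: linear_differentiable.
Qed.

Lemma is_derive_fst z v : is_derive z v (fst : R * R -> R) v.1.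
Proof. by apply: (@is_derive_linear (@fst R R)) => ?; exact: cvg_fst. Qed.

Lemma is_derive_snd z v : is_derive z v (snd : R * R -> R) v.2.
Proof. by apply: (@is_derive_linear (@snd R R)) => ?; exact: cvg_snd. Qed.

(** An arbitrary direction v is allowed because the outward normals are the
    unit vectors up to sign. *)
Lemma is_derive_eval2 P z v :
  is_derive z v (eval2 P) (v.1 * eval2 P^`() z + v.2 * eval2 (derivY P) z).
Proof.
have inner q : is_derive z v (fun z : R * R => q.[z.2]) (v.2 * q^`().[z.2]).
  elim/poly_ind: q => [|q a IH].
    rewrite (_ : (fun _ => _) = cst 0); last first.
      by apply/funext => ?; rewrite horner0.
    by rewrite deriv0 horner0 mulr0; exact: is_derive_cst.
  rewrite (_ : (fun _ => _) = (fun z : R * R => q.[z.2]) * snd + cst a);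
    last by apply/funext => ?; rewrite !hornerE.
  apply: is_derive_eq; first apply: is_deriveD (is_derive_cst _ _ _).
    by apply: is_deriveM IH (is_derive_snd _ _).
  by rewrite !(derivD, derivM, derivC, derivX, hornerE) /GRing.scale /=; ring.
elim/poly_ind: P => [|P q IH].
  rewrite eval2_0 /eval2 /derivY deriv0 map_poly0 !horner0 !mulr0 addr0.
  exact: is_derive_cst.
rewrite eval2_MXaddC; apply: is_derive_eq.
  apply: is_deriveD (inner q).
  by apply: is_deriveM IH (is_derive_fst _ _).
have -> : derivY (P * 'X + q%:P) = derivY P * 'X + q^`()%:P.
  apply/polyP => i; rewrite !(derivY_coef, coefD, coefMX, coefC).
  by case: eqP => _; rewrite derivD ?deriv0.
rewrite /eval2 !(derivD, derivM, derivC, derivX, hornerE) /GRing.scale /=.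
ring.
Qed.

Lemma pderiv1E P : pderiv x1dir (eval2 P) = eval2 P^`().
Proof.
apply/funext => z; rewrite /pderiv /unit_vec eqxx.
rewrite (@derive_val _ _ _ _ _ _ _ (is_derive_eval2 P z (1, 0))).
by rewrite mul1r mul0r addr0.
Qed.

Lemma pderiv2E P : pderiv x2dir (eval2 P) = eval2 (derivY P).
Proof.
apply/funext => z; rewrite /pderiv /unit_vec /=.
rewrite (@derive_val _ _ _ _ _ _ _ (is_derive_eval2 P z (0, 1))).
by rewrite mul1r mul0r add0r.
Qed.

Lemma edge_flux_eval2_1 c h (s : bool) P : 0 < h ->
  edge_flux c h x1dir s (eval2 P) =
  (-1) ^+ s * segment_integral c.2 h P^`().[(c.1 + (-1) ^+ s * h)%:P].
Proof.
move=> h0; rewrite -segment_integralZ -integral_shift // /edge_flux.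
apply: eq_Rintegral => r _.
rewrite (@derive_val _ _ _ _ _ _ _ (is_derive_eval2 _ _ _)).
rewrite /edge_normal /unit_vec /= /eval2 !hornerE /GRing.scale /=.
by rewrite mulr0 mul0r addr0 mulr1.
Qed.

Lemma edge_flux_eval2_2 c h (s : bool) P : 0 < h ->
  edge_flux c h x2dir s (eval2 P) =
  (-1) ^+ s *
    segment_integral c.1 h (swapXY P)^`().[(c.2 + (-1) ^+ s * h)%:P].
Proof.
move=> h0; rewrite -segment_integralZ -integral_shift // /edge_flux.
apply: eq_Rintegral => r _.
rewrite (@derive_val _ _ _ _ _ _ _ (is_derive_eval2 _ _ _)).
rewrite /edge_normal /unit_vec /= /eval2 !hornerE /GRing.scale /=.
by rewrite mulr0 mul0r add0r mulr1 derivYE horner2_swapXY.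
Qed.

Lemma continuous_eval2 P : continuous (eval2 P).
Proof.
elim/poly_ind: P => [|P q IH] z; first by rewrite eval2_0; exact: cvg_cst.
rewrite eval2_MXaddC; apply: cvgD.
  by apply: cvgM; [exact: IH|exact: cvg_fst].
by apply: continuous_comp; [exact: cvg_snd|exact: continuous_horner].
Qed.

(* The area is a measure on the product of the Borel sigma-algebras that carry
   the Lebesgue measure, which determines the measurable structure to use. *)
Let T := measurableTypeR R.
Let planar : {measure set (T * T) -> \bar R} := @area R.

Lemma measurable_eval2 P : measurable_fun setT (eval2 P : T * T -> R).
Proof.
elim/poly_ind: P => [|P q IH]; first by rewrite eval2_0; exact: measurable_cst.
rewrite eval2_MXaddC; apply: measurable_funD; first by apply: measurable_funM.
exact: (@measurableT_comp _ _ _ _ _ _ (horner q) _ snd (@measurable_poly _ q _)).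
Qed.

Lemma area_square (c : R * R) h : 0 < h -> (area (square c h) < +oo)%E.
Proof.
move=> h0; rewrite /area /square product_measure1E//= !lebesgue_measure_itv /=.
by do 2 case: ifP => _; rewrite ?mule0 ?mul0e -?EFinM ltry.
Qed.

Lemma integrable_eval2 P c h : 0 < h ->
  planar.-integrable (square c h) (EFin \o eval2 P).
Proof.
move=> h0; apply: measurable_bounded_integrable.
- exact: measurableX.
- exact: area_square.
- exact: measurable_funTS (measurable_eval2 P).
- have : compact (eval2 P @` square c h).
    apply: continuous_compact; first exact/continuous_subspaceT/continuous_eval2.
    by apply: compact_setX; exact: segment_compact.
  move=> /compact_bounded [M [Mr Mb]]; exists M; split=> // x Mx z Kz.
  by apply: Mb => //; exists z.
Qed.

End TwoVariables.

(** * Integrals of bivariate polynomials over the square *)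

Section SquareIntegral.
Variable R : realType.
Implicit Types (P Q : {poly {poly R}}) (c : R * R) (a h : R).

Local Notation mu := (@lebesgue_measure R).

Definition square_integral c h P : R :=
  \int[@area R]_(z in square c h) eval2 P z.

Lemma square_integralD c h P Q : 0 < h ->
  square_integral c h (P + Q) = square_integral c h P + square_integral c h Q.
Proof.
move=> h0; rewrite /square_integral -RintegralD //.
- by apply: eq_Rintegral => x _; rewrite eval2D.
- exact: measurableX.
- exact: integrable_eval2.
- exact: integrable_eval2.
Qed.

Lemma square_integralZ c h a P : 0 < h ->
  square_integral c h (a%:P%:P * P) = a * square_integral c h P.
Proof.
move=> h0; rewrite /square_integral -RintegralZl //.
- by apply: eq_Rintegral => x _; rewrite eval2M eval2C.
- exact: measurableX.
- exact: integrable_eval2.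
Qed.

Lemma square_integral_outer2 P c h : 0 < h ->
  square_integral c h P =
  \int[mu]_(y in `[c.2 - h, c.2 + h])
    \int[mu]_(x in `[c.1 - h, c.1 + h]) eval2 P (x, y).
Proof.
move=> h0; rewrite /square_integral /Rintegral; congr fine.
rewrite integral_mkcond -(integral21_prod_meas1 (m1 := mu) (m2 := mu)); last first.
  have := integrable_eval2 P c h0; rewrite integrable_mkcond //.
  exact: measurableX.
rewrite [RHS]integral_mkcond; apply: eq_integral => y _.
rewrite /fubini_G /patch; case: ifPn => [yI|yI].
  rewrite fineK; last first.
    have -> : (fun x => (eval2 P (x, y))%:E) =
              EFin \o horner (swapXY P).[y%:P].
      by apply/funext => x; rewrite /= horner2_swapXY.
    by apply: integrable_fin_num => //; exact: integrable_horner.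
  rewrite [RHS]integral_mkcond; apply: eq_integral => x _.
  by rewrite /patch /square in_setX yI andbT.
rewrite integral0_eq // => x _.
by rewrite /square in_setX (negbTE yI) andbF.
Qed.

Lemma square_integral_outer1 P c h : 0 < h ->
  square_integral c h P =
  \int[mu]_(x in `[c.1 - h, c.1 + h])
    \int[mu]_(y in `[c.2 - h, c.2 + h]) eval2 P (x, y).
Proof.
move=> h0; rewrite /square_integral /Rintegral; congr fine.
rewrite integral_mkcond -(integral12_prod_meas1 (m1 := mu) (m2 := mu)); last first.
  have := integrable_eval2 P c h0; rewrite integrable_mkcond //.
  exact: measurableX.
rewrite [RHS]integral_mkcond; apply: eq_integral => x _.
rewrite /fubini_F /patch; case: ifPn => [xI|xI].
  rewrite fineK; last first.
    have -> : (fun y => (eval2 P (x, y))%:E) = EFin \o horner P.[x%:P].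
      by apply/funext => y.
    by apply: integrable_fin_num => //; exact: integrable_horner.
  rewrite [RHS]integral_mkcond; apply: eq_integral => y _.
  by rewrite /patch /square in_setX xI.
rewrite integral0_eq // => y _.
by rewrite /square in_setX (negbTE xI).
Qed.

(** Since the two iterated integrals agree, statements about the second
    coordinate follow from those about the first. *)
Lemma square_integral_swap c h P : 0 < h ->
  square_integral c h (swapXY P) = square_integral (c.2, c.1) h P.
Proof.
move=> h0; rewrite square_integral_outer2 // square_integral_outer1 //=.
apply: eq_Rintegral => y _; apply: eq_Rintegral => x _.
by rewrite eval2_swap.
Qed.

(** Gauss's theorem on the square for the field (P, 0). *)
Lemma square_integral_deriv c h P : 0 < h ->
  square_integral c h P^`() =
  segment_integral c.2 h (P.[(c.1 + h)%:P] - P.[(c.1 - h)%:P]).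
Proof.
move=> h0; rewrite square_integral_outer2 //.
apply: eq_Rintegral => y _.
under eq_Rintegral do rewrite /eval2 -horner2_swapXY horner_swapXY -deriv_map /=.
rewrite integral_deriv ?centered_lt //.
by rewrite -horner_swapXY !horner2_swapXY !hornerE.
Qed.

End SquareIntegral.

(** * Polynomial spaces in terms of coefficients *)

Section Spaces.
Variable R : realType.
Implicit Types (f : R * R -> R) (P Q : {poly {poly R}}).

Definition low_degree (l : nat) P := forall i j, (l < i + j)%N -> P`_i`_j = 0.

(** The polynomials of degree at most 3 without the monomials x_1^2 x_2 and
    x_1 x_2^2. *)
Definition morley_poly P := low_degree 3 P /\ P`_2`_1 = 0 /\ P`_1`_2 = 0.

Lemma poly_space_eval2 l f : poly_space l f ->
  exists P, f = eval2 P /\ low_degree l P.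
Proof.
case=> a fE.
exists (\poly_(i < l.+1) \poly_(j < l.+1) (if (i + j <= l)%N then a i j else 0)).
split=> [|i j ij]; last first.
  rewrite coef_poly; case: ifP => _; rewrite ?coef0 // coef_poly.
  by rewrite [(i + j <= l)%N]leqNgt ij if_same.
apply/funext => x; rewrite fE /eval2 horner_poly horner_sum.
apply: eq_bigr => i _.
rewrite big_mkcond /= hornerM horner_exp hornerC horner_poly big_distrl /=.
by apply: eq_bigr => j _; case: ifP => _; [rewrite mulrAC | rewrite !mul0r].
Qed.

Lemma morley_space_eval2 f : morley_space f ->
  exists P, f = eval2 P /\ morley_poly P.
Proof.
case=> p /poly_space_eval2 [P [-> P2]] [a [b fE]].
exists (P + a%:P%:P * 'X^3 + (b *: 'X^3)%:P); split.
  by apply/funext => x; rewrite fE /eval2 !hornerE.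
have E i j : (P + a%:P%:P * 'X^3 + (b *: 'X^3)%:P)`_i`_j =
    P`_i`_j + (if (i == 3) && (j == 0) then a else 0) +
    (if (i == 0) && (j == 3) then b else 0).
  rewrite !coefD coefCM coefXn coefC -mulr_natr mul1r coefCM.
  case: (i == 3%N); case: (i == 0%N) => /=;
  by rewrite ?coef0 ?coefZ ?coefXn ?coef1; case: (j == 0%N); case: (j == 3%N);
     rewrite ?(mulr1, mulr0).
split=> [i j ij|]; last by rewrite !E !P2 ?addr0.
rewrite E P2 ?add0r; last by apply: leq_trans ij.
case: ifP => [/andP[/eqP i3 /eqP j0]|_]; first by rewrite i3 j0 in ij.
case: ifP => [/andP[/eqP i3 /eqP j0]|_]; first by rewrite i3 j0 in ij.
by rewrite addr0.
Qed.

Lemma low_degree_swap l P : low_degree l P -> low_degree l (swapXY P).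
Proof. by move=> lP i j ij; rewrite coef_swapXY lP // addnC. Qed.

Lemma morley_poly_swap P : morley_poly P -> morley_poly (swapXY P).
Proof.
case=> P3 [P21 P12]; split; first exact: low_degree_swap.
by rewrite !coef_swapXY.
Qed.

Lemma morley_poly_dxx P : morley_poly P ->
  exists a b, P^`()^`() = (a%:P + b *: 'X)^:P.
Proof.
case=> P3 [P21 P12].
(* The second derivatives of x_1^2 and x_1^3 are 2 and 6 x_1. *)
exists (P`_2`_0 *+ 2), (P`_3`_0 *+ 6).
apply/polyP => i; apply/polyP => j.
have -> : P^`()^`()`_i`_j = P`_i.+2`_j *+ (i.+2 * i.+1).
  by rewrite !coef_deriv !coefMn mulrnA.
rewrite coef_map /= coefC coefD coefZ coefX coefC.
case: i => [|[|i]]; case: j => [|[|j]] /=;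
  by rewrite ?(mulr1, mulr0, addr0, add0r) // ?P21 ?P3 ?mul0rn.
Qed.

Lemma morley_poly_dxy P : morley_poly P -> exists a, derivY P^`() = a%:P%:P.
Proof.
case=> P3 [P21 P12]; exists (P`_1`_1).
apply/polyP => i; apply/polyP => j.
rewrite derivY_coef !(coefC, coef_deriv, coefMn) /=.
case: i => [|[|i]]; case: j => [|[|j]] /=; rewrite ?coefC ?coef0 //=;
  by rewrite ?P12 ?P21 ?P3 ?mul0rn //= ?addSn ?addnS.
Qed.

Lemma low_degree_dxyyyy P : low_degree 4 P ->
  derivY (derivY (derivY (derivY P^`()))) = 0.
Proof.
move=> P4; apply/polyP => i; apply/polyP => j.
rewrite !(derivY_coef, coef0, coef_deriv, coefMn) P4 ?mul0rn //.
by rewrite addSn !addnS.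
Qed.

End Spaces.

(** * Polynomials with vanishing degrees of freedom *)

Section Vanishing.
Variable R : realType.
Implicit Types (g : {poly R}) (W : {poly {poly R}}) (c : R * R) (h b : R).

Lemma integral_mixed_derivative c h W : 0 < h ->
  (forall s t, eval2 W (vertex c h s t) = 0) ->
  square_integral c h (derivY W^`()) = 0.
Proof.
move=> h0 W0; rewrite derivY_deriv square_integral_deriv // !horner_derivY -derivB.
rewrite segment_integral_deriv //.
have := (W0 false false, W0 false true, W0 true false, W0 true true).
rewrite /eval2 /vertex /= !expr0 !expr1 !mul1r !mulN1r !hornerE.
by case=> -[] [-> ->] -> ->; rewrite !subrr.
Qed.

(** The jump q of W between the two edges normal to x_1 vanishes at its end
    points, and q'''' = 0 because the fourth x_2-derivative of W does not depend
    on x_1; so the corrected trapezoidal rule gives the integral of q. *)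
Lemma integral_dx_vanishing c h W : 0 < h ->
  (forall s t, eval2 W (vertex c h s t) = 0) ->
  derivY (derivY (derivY (derivY W^`()))) = 0 ->
  square_integral c h W^`() =
  - (h ^+ 2 / 3) * square_integral c h (derivY (derivY W^`())).
Proof.
move=> h0 W0 W4; rewrite !derivY_deriv !square_integral_deriv //.
rewrite !horner_derivY -!derivB; set q := _ - _.
have q0 : q.[c.2 + h] = 0 /\ q.[c.2 - h] = 0.
  have := (W0 false false, W0 false true, W0 true false, W0 true true).
  rewrite /eval2 /vertex /q /= !expr0 !expr1 !mul1r !mulN1r !hornerE.
  by case=> -[] [-> ->] -> ->; rewrite !subrr.
rewrite corrected_trapezoid //.
  by rewrite q0.1 q0.2 addr0 mulr0 sub0r mulNr.
rewrite /q !derivB -!horner_derivY.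
move: W4; rewrite !derivY_deriv => /deriv_eq0_polyC ->.
by rewrite !hornerC subrr.
Qed.

(** Integration by parts in x_1: on an edge normal to x_1 the factor g is
    constant, so the boundary terms are multiples of the vanishing fluxes. *)
Lemma integral_dxx_vanishing c h W g b : 0 < h ->
  (forall s t, eval2 W (vertex c h s t) = 0) ->
  (forall s : bool,
     segment_integral c.2 h W^`().[(c.1 + (-1) ^+ s * h)%:P] = 0) ->
  low_degree 4 W ->
  g^`() = b%:P ->
  square_integral c h (W^`()^`() * g^:P) =
  h ^+ 2 / 3 * square_integral c h (derivY (derivY W^`()) * b%:P%:P).
Proof.
move=> h0 W0 F0 /low_degree_dxyyyy W4 g'.
have -> : W^`()^`() * g^:P = (W^`() * g^:P)^`() + (- b)%:P%:P * W^`().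
  by rewrite derivM deriv_map g' map_polyC /= !polyCN; ring.
rewrite [X in _ = _ * square_integral _ _ X]mulrC.
rewrite square_integralD // !square_integralZ //.
rewrite [in LHS]square_integral_deriv // integral_dx_vanishing //.
rewrite segment_integralB.
have F x : segment_integral c.2 h W^`().[x%:P] = 0 ->
    segment_integral c.2 h (W^`() * g^:P).[x%:P] = 0.
  move=> Wx.
  by rewrite hornerM horner_map /= mulrC mul_polyC segment_integralZ Wx mulr0.
have := F0 false; have := F0 true; rewrite expr0 expr1 mul1r mulN1r.
by move=> /F -> /F ->; ring.
Qed.

Lemma integral_dyy_vanishing c h W g b : 0 < h ->
  (forall s t, eval2 W (vertex c h s t) = 0) ->
  (forall s : bool,
     segment_integral c.1 h (swapXY W)^`().[(c.2 + (-1) ^+ s * h)%:P] = 0) ->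
  low_degree 4 W ->
  g^`() = b%:P ->
  square_integral c h (derivY (derivY W) * g%:P) =
  h ^+ 2 / 3 * square_integral c h ((derivY W)^`()^`() * b%:P%:P).
Proof.
move=> h0 W0 F0 W4 g'.
have := @integral_dxx_vanishing (c.2, c.1) h (swapXY W) g b h0 _ F0 _ g'.
rewrite -!square_integral_swap // !rmorphM /=.
rewrite !(swapXY_deriv, swapXY_derivY, swapXYK).
rewrite swapXY_map_polyC !swapXY_polyC map_polyC /=.
apply; last exact: low_degree_swap.
by move=> s t; rewrite eval2_swap; exact: W0.
Qed.

End Vanishing.

(** * Existence of the interpolant *)

Section Interpolant.
Variable R : realType.
Implicit Types (p q : {poly R}) (P : {poly {poly R}}) (c z : R * R) (h : R).

Definition cubic (b0 b1 b2 b3 : R) : {poly R} :=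
  b0%:P + b1 *: 'X + b2 *: 'X^2 + b3 *: 'X^3.

Lemma horner_cubic b0 b1 b2 b3 x :
  (cubic b0 b1 b2 b3).[x] = b0 + b1 * x + b2 * x ^+ 2 + b3 * x ^+ 3.
Proof. by rewrite /cubic !(hornerD, hornerZ, hornerC, hornerX, hornerXn). Qed.

Lemma horner_cubic_deriv b0 b1 b2 b3 x :
  (cubic b0 b1 b2 b3)^`().[x] = b1 + 2 * b2 * x + 3 * b3 * x ^+ 2.
Proof.
rewrite /cubic !(derivD, derivZ, derivC, derivX, derivXn) /=.
rewrite !(hornerD, hornerZ, hornerC, hornerX, hornerXn, hornerMn).
ring.
Qed.

(** For cubics p and q this is the general element of the Morley space, in
    coordinates centred at c. *)
Definition morley_sum c p q (a : R) : {poly {poly R}} :=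
  (p \Po ('X - c.1%:P))^:P + (q \Po ('X - c.2%:P))%:P +
  a%:P%:P * (('X - c.1%:P%:P) * ('X - c.2%:P)%:P).

Lemma morley_sum_swap c p q a :
  swapXY (morley_sum c p q a) = morley_sum (c.2, c.1) q p a.
Proof.
rewrite /morley_sum 2!rmorphD /= swapXY_map_polyC swapXY_polyC.
rewrite 2!rmorphM rmorphB /= !swapXY_polyC swapXY_X rmorphB /= map_polyX.
by rewrite !map_polyC /= polyCB; ring.
Qed.

Lemma morley_sumE c p q a z :
  eval2 (morley_sum c p q a) z =
  p.[z.1 - c.1] + q.[z.2 - c.2] + a * ((z.1 - c.1) * (z.2 - c.2)).
Proof.
rewrite /eval2 /morley_sum !(hornerD, hornerM, hornerC, horner_map) /=.
by rewrite !(horner_comp, hornerC, hornerD, hornerN, hornerX).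
Qed.

Lemma morley_sum_space c b0 b1 b2 b3 d0 d1 d2 d3 a :
  morley_space (eval2 (morley_sum c (cubic b0 b1 b2 b3) (cubic d0 d1 d2 d3) a)).
Proof.
case: c => x y.
set P := morley_sum _ _ _ _.
exists (fun z => eval2 P z - b3 * z.1 ^+ 3 - d3 * z.2 ^+ 3); last first.
  by exists b3, d3 => z; ring.
(* Rows and columns list the powers of x_1 and x_2 in the expansion of the
   quadratic part around the origin. *)
exists (fun i j => nth 0 (nth [::] [::
  [:: b0 - b1 * x + b2 * x ^+ 2 - b3 * x ^+ 3 +
      d0 - d1 * y + d2 * y ^+ 2 - d3 * y ^+ 3 + a * x * y;
      d1 - 2 * d2 * y + 3 * d3 * y ^+ 2 - a * x; d2 - 3 * d3 * y];
  [:: b1 - 2 * b2 * x + 3 * b3 * x ^+ 2 - a * y; a];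
  [:: b2 - 3 * b3 * x]] i) j) => z.
rewrite /P morley_sumE !horner_cubic /=.
rewrite 3!big_ord_recl big_ord0.
do 3 rewrite big_mkcond 3!big_ord_recl big_ord0 /=.
by rewrite /bump /=; ring.
Qed.

(** The bilinear term contributes a (x_2 - c_2) to the x_1-derivative, which has
    mean zero on the edge. *)
Lemma morley_sum_flux c h p q a (x : R) : 0 < h ->
  segment_integral c.2 h (morley_sum c p q a)^`().[x%:P] =
  2 * h * p^`().[x - c.1].
Proof.
move=> h0; rewrite -(@segment_integral_affine _ c.2 h _ a) //.
congr segment_integral.
have XC' (S : comNzRingType) (b : S) : ('X - b%:P)^`() = 1.
  by rewrite derivB derivX derivC subr0.
rewrite /morley_sum 2!derivD derivC deriv_map deriv_comp !derivM !derivC !XC'.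
rewrite !(mul0r, mul1r, mulr1, mulr0, add0r, addr0) hornerD horner_map.
rewrite hornerM !hornerC /= horner_comp hornerXsubC.
by rewrite mul_polyC.
Qed.

(** The sum and the difference of the two fluxes F give 8 h^2 b2 and
    4 h (b1 + 3 h^2 b3), and the jump E1 of the vertex values in the first
    coordinate gives 4 (h b1 + h^3 b3); likewise in the second coordinate.  The
    alternating sum and the mean of the vertex values then give a and b0. *)
Lemma morley_dofs_solvable h (m : bool -> bool -> R) (F G : bool -> R) : 0 < h ->
  exists b0 b1 b2 b3 d1 d2 d3 a,
    let p := cubic b0 b1 b2 b3 in let q := cubic 0 d1 d2 d3 in
    [/\ forall s t : bool, p.[(-1) ^+ s * h] + q.[(-1) ^+ t * h] +
           a * (((-1) ^+ s * h) * ((-1) ^+ t * h)) = m s t,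
        forall s : bool, (-1) ^+ s * (2 * h * p^`().[(-1) ^+ s * h]) = F s
      & forall s : bool, (-1) ^+ s * (2 * h * q^`().[(-1) ^+ s * h]) = G s].
Proof.
move=> h0; have hn : h != 0 by rewrite gt_eqF.
pose E1 := m false false + m false true - m true false - m true true.
pose E2 := m false false - m false true + m true false - m true true.
pose b2 := (F false + F true) / (8 * h ^+ 2).
pose d2 := (G false + G true) / (8 * h ^+ 2).
pose b3 := (F false - F true - E1) / (8 * h ^+ 3).
pose d3 := (G false - G true - E2) / (8 * h ^+ 3).
exists ((m false false + m false true + m true false + m true true) / 4
  - h ^+ 2 * (b2 + d2)), (E1 / (4 * h) - h ^+ 2 * b3), b2, b3,
  (E2 / (4 * h) - h ^+ 2 * d3), d2, d3,
  ((m false false - m false true - m true false + m true true) / (4 * h ^+ 2)).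
move=> p q; rewrite /p /q {p q}; split=> [s t|s|s];
  rewrite ?horner_cubic ?horner_cubic_deriv /b2 /b3 /d2 /d3 /E1 /E2.
- by case: s t => [] []; rewrite ?expr0 ?expr1; field; exact: hn.
- by case: s; rewrite ?expr0 ?expr1; field; exact: hn.
- by case: s; rewrite ?expr0 ?expr1; field; exact: hn.
Qed.

Lemma morley_interpolates_exist c h f : 0 < h ->
  exists w, morley_interpolates c h f w.
Proof.
move=> h0.
have [b0 [b1 [b2 [b3 [d1 [d2 [d3 [a [/= V F G]]]]]]]]] :=
  morley_dofs_solvable (fun s t => f (vertex c h s t))
    (fun s => edge_flux c h x1dir s f) (fun s => edge_flux c h x2dir s f) h0.
have xDx (x d : R) : x + d - x = d by rewrite addrAC subrr add0r.
exists (eval2 (morley_sum c (cubic b0 b1 b2 b3) (cubic 0 d1 d2 d3) a)); split.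
- exact: morley_sum_space.
- by move=> s t; rewrite morley_sumE /= !xDx.
- move=> i s; case: (i =P x1dir) => [->|].
    by rewrite edge_flux_eval2_1 // morley_sum_flux // xDx.
  move=> i0; have -> : i = x2dir.
    by apply: val_inj; case: i i0 => -[|[|]] // ? [] //; exact: val_inj.
  rewrite edge_flux_eval2_2 // morley_sum_swap.
  by rewrite (@morley_sum_flux (c.2, c.1)) // xDx.
Qed.

Lemma morley_interpP c h f : 0 < h ->
  morley_interpolates c h f (morley_interp c h f).
Proof. by move=> h0; apply: xgetPex; exact: morley_interpolates_exist. Qed.

End Interpolant.

(** * The Hessian of the interpolation error *)

Lemma hess_innerE (R : realType) (K : set (R * R)) (f g : R * R -> R) :
  hess_inner K f g = \int[@area R]_(z in K)
    (pderiv x1dir (pderiv x1dir f) z * pderiv x1dir (pderiv x1dir g) z +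
     pderiv x1dir (pderiv x2dir f) z * pderiv x1dir (pderiv x2dir g) z +
     (pderiv x2dir (pderiv x1dir f) z * pderiv x2dir (pderiv x1dir g) z +
      pderiv x2dir (pderiv x2dir f) z * pderiv x2dir (pderiv x2dir g) z)).
Proof.
have sum2 (F : 'I_2 -> R) : \sum_i F i = F x1dir + F x2dir.
  by rewrite 2!big_ord_recl big_ord0 addr0; congr (_ + F _); apply: val_inj.
have E (z : R * R) i j :
    hessian f z i j * hessian g z i j =
    pderiv i (pderiv j f) z * pderiv i (pderiv j g) z by rewrite !mxE.
by apply: eq_Rintegral => z _; rewrite sum2 !sum2; congr (_ + _ + (_ + _)); exact: E.
Qed.

Theorem lemma2p2 (R : realType) (c : R * R) (h : R) (h_gt0 : 0 < h)
    (u v : R * R -> R) (uP4 : poly_space 4 u) (vPT : morley_space v) :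
  let K := square c h in
  hess_inner K (fun x => u x - morley_interp c h u x) v =
    h ^+ 2 / 3 *
      (\int[@area R]_(x in K)
         (pderiv x1dir (pderiv x2dir (pderiv x2dir u)) x *
          pderiv x1dir (pderiv x1dir (pderiv x1dir v)) x)) +
    h ^+ 2 / 3 *
      (\int[@area R]_(x in K)
         (pderiv x1dir (pderiv x1dir (pderiv x2dir u)) x *
          pderiv x2dir (pderiv x2dir (pderiv x2dir v)) x)).
Proof.
move=> K.
have [wM wV wF] := morley_interpP c u h_gt0.
have [Q [QE QM]] := morley_space_eval2 wM.
have [V [vE VM]] := morley_space_eval2 vPT.
have [U [uE U4]] := poly_space_eval2 uP4.
move: wV wF; rewrite {wM vPT uP4} QE uE vE => wV wF.
pose W := U - Q.
have WE : (fun x => eval2 U x - eval2 Q x) = eval2 W.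
  by apply/funext => z; rewrite eval2B.
have W0 s t : eval2 W (vertex c h s t) = 0 by rewrite eval2B wV subrr.
have W4 : low_degree 4 W.
  by move=> i j ij; rewrite !coefB U4 // QM.1 ?subrr // ltnW.
have F1 (s : bool) :
    segment_integral c.2 h W^`().[(c.1 + (-1) ^+ s * h)%:P] = 0.
  have := wF x1dir s; rewrite !edge_flux_eval2_1 //.
  move=> /(mulfI (negbT (signr_eq0 _ s))) E.
  by rewrite derivB hornerD hornerN segment_integralB E subrr.
have F2 (s : bool) :
    segment_integral c.1 h (swapXY W)^`().[(c.2 + (-1) ^+ s * h)%:P] = 0.
  have := wF x2dir s; rewrite !edge_flux_eval2_2 //.
  move=> /(mulfI (negbT (signr_eq0 _ s))) E.
  by rewrite raddfB derivB hornerD hornerN segment_integralB E subrr.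
have [a1 [b1 V11]] := morley_poly_dxx VM.
have [a2 [b2]] := morley_poly_dxx (morley_poly_swap VM).
move=> /(congr1 swapXY); rewrite !swapXY_deriv swapXYK swapXY_map_polyC => V22.
have [a3 V12] := morley_poly_dxy VM.
have [a4 Q12] := morley_poly_dxy QM.
set g1 := _ + _ in V11; set g2 := _ + _ in V22.
have g' (a b : R) : (a%:P + b *: 'X)^`() = b%:P.
  by rewrite derivD derivC derivZ derivX add0r alg_polyC.
have hessE : hess_inner K (eval2 W) (eval2 V) =
    square_integral c h (W^`()^`() * g1^:P + derivY (derivY W) * g2%:P +
                         (a3 *+ 2)%:P%:P * derivY W^`()).
  rewrite hess_innerE !(pderiv1E, pderiv2E) -!derivY_deriv V11 V22 V12.
  apply: eq_Rintegral => z _.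
  rewrite !(eval2D, eval2M, eval2C) mulr2n; ring.
rewrite WE hessE !square_integralD // square_integralZ //.
rewrite integral_mixed_derivative // mulr0 addr0.
rewrite (integral_dxx_vanishing h_gt0 W0 F1 W4 (g' a1 b1)).
rewrite (integral_dyy_vanishing h_gt0 W0 F2 W4 (g' a2 b2)).
(* The third derivatives of W and U agree since d_12 Q is constant. *)
congr (_ * _ + _ * _); apply: eq_Rintegral => z _;
  rewrite !(pderiv1E, pderiv2E) eval2M.
- rewrite V11 deriv_map g' map_polyC /=; congr (_ * _).
  by rewrite -!derivY_deriv derivB !derivYB Q12 derivYC derivC polyC0 subr0.
- rewrite V22 derivYC g'; congr (_ * _).
  by rewrite derivYB derivB -(derivY_deriv Q) Q12 derivB derivC subr0.
Qed.
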